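(* Let $G$ be a two-connected triangle-free graph with $N$ vertices. If there exist $N-2$ mutually orthogonal Latin squares of order $d_0\ge2$, then $(G,(d_0,d_0,\dots,d_0))$ does not satisfy the interior point property.
   Context: Graphs are finite, simple, undirected, with vertex set $[N]=\{1,\dots,N\}$ for some integer $N>1$. A graph is triangle-free if it does not contain a cycle of length three. A graph is two-connected if it remains connected when a single node is eliminated. A Latin square of order $d$ is a $d\times d$ matrix with entries in $[d]=\{1,\dots,d\}$ such that each number in $[d]$ appears exactly once in each row and in each column. Two Latin squares $L,L'$ of order $d$ are orthogonal if $(L_{i,j},L'_{i,j})=(L_{k,l},L'_{k,l})$ implies $i=k$ and $j=l$; a family is mutually orthogonal if its members are pairwise orthogonal. Let $d=(d_v)_{v\in[N]}$ with integers $d_v\ge2$, $\mathcal X=\prod_v[d_v]$, $x_W=(x_v)_{v\in W}$. $\mathcal B_{\mathrm{gl}(G)}\subset\mathbb Z^{\mathcal X}$ is the set of all moves $e_{x_Ax_Bx_C}+e_{x'_Ax'_Bx_C}-e_{x_Ax'_Bx_C}-e_{x'_Ax_Bx_C}$ ($e_x$ = unit vectors), where $A,B,C$ range over all partitions $[N]=A\cup B\cup C$ into disjoint (possibly empty) sets such that every path in $G$ from a vertex of $A$ to a vertex of $B$ meets $C$, and $x_A,x'_A,x_B,x'_B,x_C$ range over all states of the respective subsets. $A_G$ is the integer matrix with $(A_Gu)_{W,y}=\sum_{x\in\mathcal X:\,x_W=y}u_x$ for every clique $W$ of $G$ and $y\in\prod_{v\in W}[d_v]$. The fiber of $u\in\mathbb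 N^{\mathcal X}$ is $\{v\in\mathbb N^{\mathcal X}:A_Gv=A_Gu\}$ ($0\in\mathbb N$). It is connected by $\mathcal B_{\mathrm{gl}(G)}$ if any two of its elements are joined by a finite sequence in $\mathbb N^{\mathcal X}$ whose consecutive differences lie in $\pm\mathcal B_{\mathrm{gl}(G)}$. $(G,d)$ has (satisfies) the interior point property if, for every $u\in\mathbb N^{\mathcal X}$ such that $A_Gu$ lies in the relative interior of the cone generated by the columns of $A_G$, the fiber of $u$ is connected by $\mathcal B_{\mathrm{gl}(G)}$.
   Formalization: Two-connected graphs are required to have more than two vertices, which excludes only the single edge (N=2): there zero Latin squares exist vacuously, but every fiber is a singleton, so the interior point property holds and the claim as stated fails. *)

(* Defs.v *)
From HB Require Import structures.
From mathcomp Require Import all_boot all_order all_algebra.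
From mathcomp Require Import all_classical all_reals all_analysis.
Set Implicit Arguments.
Unset Strict Implicit.
Unset Printing Implicit Defensive.
Import Order.TTheory GRing.Theory Num.Theory.
Import numFieldNormedType.Exports.
Local Open Scope ring_scope.

(** * Graphs *)

Record sgraph (N : nat) := SGraph {
  adj :> rel 'I_N;
  adj_sym : symmetric adj;
  adj_irrefl : irreflexive adj }.

Definition connected_on (N : nat) (G : sgraph N) (S : {set 'I_N}) : Prop :=
  {in S &, forall v w : 'I_N,
    connect [rel a b | [&& a \in S, b \in S & G a b]] v w}.

(* As usual for k-connectivity, a two-connected graph has more than two
   vertices.  This excludes the single edge, which has no cut vertex but whose
   fibers are all singletons. *)
Definition two_connected (N : nat) (G : sgraph N) : Prop :=
  [/\ (2 < N)%N,
      connected_on G [set: 'I_N]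
    & forall v : 'I_N, connected_on G [set~ v]].

Definition triangle_free (N : nat) (G : sgraph N) : Prop :=
  ~ exists c : seq 'I_N, ucycle G c /\ size c = 3.

Definition clique (N : nat) (G : sgraph N) (W : {set 'I_N}) : bool :=
  [forall v in W, forall w in W, (v != w) ==> G v w].

Definition separates (N : nat) (G : sgraph N) (A B C : {set 'I_N}) : Prop :=
  forall (a : 'I_N) (p : seq 'I_N),
    path G a p -> uniq (a :: p) -> a \in A -> last a p \in B ->
    has (fun v => v \in C) (a :: p).

(* Partition into three parts, any of which may be empty. *)
Definition tripartition (N : nat) (A B C : {set 'I_N}) : bool :=
  [&& A :|: B :|: C == [set: 'I_N],
      [disjoint A & B], [disjoint A & C] & [disjoint B & C]].

(** * Latin squares *)

Definition latin_square (d : nat) (L : 'M['I_d]_d) : Prop :=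
  (forall i k : 'I_d, exists! j : 'I_d, L i j = k) /\
  (forall j k : 'I_d, exists! i : 'I_d, L i j = k).

Definition orthogonal_squares (d : nat) (L L' : 'M['I_d]_d) : Prop :=
  forall i j k l : 'I_d,
    (L i j, L' i j) = (L k l, L' k l) -> i = k /\ j = l.

Definition mutually_orthogonal_latin_squares (d k : nat)
    (L : 'I_k -> 'M['I_d]_d) : Prop :=
  (forall i : 'I_k, latin_square (L i)) /\
  (forall i j : 'I_k, i != j -> orthogonal_squares (L i) (L j)).

(** * The graphical model *)

(* The state space [d_v] of the vertex v is represented by 'I_(d v). *)
Definition state (N : nat) (d : 'I_N -> nat) : finType :=
  {dffun forall v : 'I_N, 'I_(d v)}.

Definition substate (N : nat) (d : 'I_N -> nat) (W : {set 'I_N}) : finType :=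
  {dffun forall v : {v : 'I_N | v \in W}, 'I_(d (val v))}.

Definition restrict (N : nat) (d : 'I_N -> nat) (W : {set 'I_N})
    (x : state d) : substate d W :=
  [ffun v : {v : 'I_N | v \in W} => x (val v)].

(* The pairs (W, y) with W a clique and y a state of W. *)
Definition margin_index (N : nat) (G : sgraph N) (d : 'I_N -> nat) : finType :=
  {W : {W : {set 'I_N} | clique G W} & substate d (val W)}.

(* Vectors indexed by states or by margin indices are column vectors whose
   coordinates follow the enumeration of these finite types. *)
Definition design_matrix (N : nat) (G : sgraph N) (d : 'I_N -> nat) :
    'M[int]_(#|margin_index G d|, #|state d|) :=
  \matrix_(i, j)
    (let Wy := enum_val i in
     restrict (val (tag Wy)) (enum_val j) == tagged Wy)%:R.

Lemma design_matrixE (N : nat) (G : sgraph N) (d : 'I_N -> nat)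
    (u : 'cV[int]_#|state d|) (Wy : margin_index G d) :
  (design_matrix G d *m u) (enum_rank Wy) 0 =
  \sum_(x : state d | restrict (val (tag Wy)) x == tagged Wy)
    u (enum_rank x) 0.
Proof.
rewrite mxE [RHS]big_mkcond /= (reindex (@enum_rank (state d))) /=; last first.
  by exists enum_val => x _; rewrite ?enum_rankK ?enum_valK.
apply: eq_bigr => x _; rewrite mxE !enum_rankK /=.
by case: ifP => _; rewrite ?mul1r ?mul0r.
Qed.

Definition unit_vector (N : nat) (d : 'I_N -> nat) (x : state d) :
    'cV[int]_#|state d| :=
  delta_mx (enum_rank x) 0.

(* The state whose restriction to A, B and the complement of A :|: B is that
   of a, b and c respectively (for A and B disjoint). *)
Definition glue (N : nat) (d : 'I_N -> nat) (A B : {set 'I_N})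
    (a b c : state d) : state d :=
  [ffun v => if v \in A then a v else if v \in B then b v else c v].

(* The states x_A, x_B, x_C are the restrictions of x, while x'_A and x'_B are
   those of x'; the values of x' on C are irrelevant. *)
Definition global_move (N : nat) (G : sgraph N) (d : 'I_N -> nat)
    (m : 'cV[int]_#|state d|) : Prop :=
  exists (A B C : {set 'I_N}) (x x' : state d),
    [/\ tripartition A B C,
        separates G A B C
      & m = unit_vector (glue A B x x x) + unit_vector (glue A B x' x' x)
            - unit_vector (glue A B x x' x) - unit_vector (glue A B x' x x)].

Definition vecZ (n : nat) (u : 'cV[nat]_n) : 'cV[int]_n := map_mx Posz u.

Definition in_fiber (N : nat) (G : sgraph N) (d : 'I_N -> nat)
    (u v : 'cV[nat]_#|state d|) : Prop :=
  design_matrix G d *m vecZ v = design_matrix G d *m vecZ u.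

Definition joined_by (n : nat) (moves : 'cV[int]_n -> Prop)
    (v v' : 'cV[nat]_n) : Prop :=
  exists (k : nat) (w : nat -> 'cV[nat]_n),
    [/\ w 0%N = v, w k = v'
      & forall i : nat, (i < k)%N ->
          moves (vecZ (w i.+1) - vecZ (w i)) \/
          moves (- (vecZ (w i.+1) - vecZ (w i)))].

Definition fiber_connected (N : nat) (G : sgraph N) (d : 'I_N -> nat)
    (u : 'cV[nat]_#|state d|) : Prop :=
  forall v v' : 'cV[nat]_#|state d|,
    in_fiber G u v -> in_fiber G u v' -> joined_by (@global_move N G d) v v'.

(** * Cones and relative interiors *)

Definition cone_of_columns (R : realType) (m n : nat) (A : 'M[R]_(m, n))
    (z : 'cV[R]_m) : Prop :=
  exists c : 'I_n -> R,
    (forall j : 'I_n, 0 <= c j) /\ z = \sum_(j < n) c j *: col j A.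

Definition affine_hull (R : realType) (m : nat) (S : 'cV[R]_m -> Prop)
    (z : 'cV[R]_m) : Prop :=
  exists (k : nat) (s : 'I_k -> 'cV[R]_m) (c : 'I_k -> R),
    [/\ forall i : 'I_k, S (s i),
        \sum_(i < k) c i = 1
      & z = \sum_(i < k) c i *: s i].

(* Interior relative to the affine hull; the topology on column vectors is the
   usual one, induced by the sup norm. *)
Definition relative_interior (R : realType) (m : nat) (S : 'cV[R]_m -> Prop)
    (z : 'cV[R]_m) : Prop :=
  S z /\ \forall w \near z, affine_hull S w -> S w.

Definition interior_point_property (R : realType) (N : nat) (G : sgraph N)
    (d : 'I_N -> nat) : Prop :=
  forall u : 'cV[nat]_#|state d|,
    relative_interior (cone_of_columns (map_mx intr (design_matrix G d)))
      (map_mx intr (design_matrix G d *m vecZ u) : 'cV[R]_#|margin_index G d|) ->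
    fiber_connected G u.

(* Main.v *)
(* The N - 2 orthogonal squares, together with the row and column indices, form
   an orthogonal array: any two distinct coordinates determine a row.  In a
   triangle-free graph cliques have at most two vertices, so all orthogonal
   arrays have the same margins, proportional to those of the uniform table;
   hence these margins are in the relative interior.  Two distinct rows agree
   in at most one coordinate, whereas a nontrivial global move in a
   two-connected graph needs two rows agreeing on a separator C with at least
   two vertices.  So the array is isolated in its fiber, but permuting the
   symbols of one coordinate gives another element of that fiber. *)

Require Import Defs.
From mathcomp Require Import all_boot all_order all_algebra.
From mathcomp Require Import all_classical all_reals all_analysis.
From mathcomp Require Import perm.

Set Implicit Arguments.
Unset Strict Implicit.
Unset Printing Implicit Defensive.
Import Order.TTheory GRing.Theory Num.Theory.
Import numFieldNormedType.Exports.

(** * Relative interior of a finitely generated cone *)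

Section RelativeInterior.
Local Open Scope ring_scope.
Variables (R : realType) (m n : nat) (A : 'M[R]_(m, n)).

Lemma cone_of_columnsE (z : 'cV[R]_m) :
  cone_of_columns A z <->
  exists2 c : 'cV[R]_n, (forall j, 0 <= c j 0) & z = A *m c.
Proof.
have sumE (c : 'I_n -> R) : \sum_j c j *: col j A = A *m \col_j c j.
  apply/colP => i; rewrite summxE mxE; apply: eq_bigr => j _.
  by rewrite !mxE mulrC.
split=> [[c [c0 ->]]|[c c0 ->]].
  by exists (\col_j c j) => [j|]; rewrite ?mxE.
exists (fun j => c j 0); split=> //; rewrite sumE; congr (_ *m _).
by apply/colP => j; rewrite mxE.
Qed.

Lemma affine_hull_cone_of_columns (z : 'cV[R]_m) :
  affine_hull (cone_of_columns A) z -> exists b : 'cV[R]_n, z = A *m b.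
Proof.
case=> k [s [c [/(_ _)/cone_of_columnsE/cid2-/all_sig2[b _ sb] _ ->]]].
exists (\sum_i c i *: b i); rewrite mulmx_sumr; apply: eq_bigr => i _.
by rewrite sb scalemxAr.
Qed.

(** A nearby point of the affine hull differs from [A *m c] by a small vector of the column space.
    That vector lifts linearly to a perturbation of [c], too small to make any coordinate
    negative. *)
Lemma relative_interior_cone_of_columns (c : 'cV[R]_n) :
  (forall j, 0 < c j 0) ->
  relative_interior (cone_of_columns A) (A *m c).
Proof.
move=> c0; split; first by apply/cone_of_columnsE; exists c => // j; exact: ltW.
(* Transposing turns the row-space pseudoinverse into a map with [A *m (P *m y) = y] for every [y]
   in the column space of [A]. *)
pose P := (pinvmx A^T)^T.
(* [M] bounds the l1 norm of each row of [P], so entries of [y] of size at most [k / M] keep those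
   of [P *m y] below the least coordinate of [c]. The 1 in the minimum covers [n = 0]. *)
pose M := 1 + \sum_j \sum_i `|P j i|.
have M0 : 0 < M by rewrite ltr_pwDl// sumr_ge0// => j _; exact: sumr_ge0.
pose k := \big[Order.min/1]_j c j 0.
have k0 : 0 < k by rewrite /k; elim/big_ind: _ => // x y x0 y0; rewrite lt_min x0.
apply/nbhs_ballP; exists (k / M) => /=; first exact: divr_gt0.
move=> w [_ zw] /affine_hull_cone_of_columns[b wb].
pose y := w - A *m c.
have yE : y = A *m (P *m y).
  have : (y^T <= A^T)%MS.
    by rewrite /y wb -mulmxBr trmx_mul submxMl.
  by move/mulmxKpV/(congr1 trmx); rewrite trmx_mul (trmx_mul y^T) !trmxK => /esym.
apply/cone_of_columnsE; exists (c + P *m y) => [j|]; last first.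
  by rewrite mulmxDr -yE addrC subrK.
have y_small i : `|y i 0| <= k / M.
  by have := zw i 0; rewrite /ball /= distrC !mxE => /ltW.
have Py_small : `|(P *m y) j 0| <= k.
  rewrite mxE (le_trans (ler_norm_sum _ _ _))//.
  rewrite (@le_trans _ _ (\sum_i `|P j i| * (k / M)))//.
    by apply: ler_sum => i _; rewrite normrM ler_wpM2l.
  rewrite -mulr_suml mulrCA ger_pMr// ler_pdivrMr// mul1r.
  rewrite /M (bigD1 j)//= addrCA lerDl addr_ge0// sumr_ge0// => l _.
  exact: sumr_ge0.
rewrite mxE -lerBlDr sub0r (le_trans _ (bigmin_le 1 j (fun j => c j 0)))//.
by rewrite -/k (le_trans _ Py_small)// -normrN ler_norm.
Qed.
End RelativeInterior.

(** * Orthogonal arrays and their margins *)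

Section OrthogonalArrays.
Variables (N d0 : nat) (G : sgraph N).
Notation d := (fun _ : 'I_N => d0).
Notation T := ('I_d0 * 'I_d0)%type.

(** The rows are indexed by pairs of symbols, so injectivity is bijectivity: in any two columns each
    pair of symbols occurs exactly once. *)
Definition orthogonal_array (f : T -> state d) :=
  forall v w : 'I_N, v != w -> injective (fun p => (f p v, f p w)).

Definition row_count (f : T -> state d) : 'cV[nat]_#|state d| :=
  \col_j #|[pred p | f p == enum_val j]|.

Definition twist (s : {ffun 'I_N -> {perm 'I_d0}}) (f : T -> state d) (p : T) :
    state d :=
  [ffun v => s v (f p v)].

Lemma orthogonal_array_twist s f :
  orthogonal_array f -> orthogonal_array (twist s f).
Proof.
move=> fo v w vw p q; rewrite !ffunE => -[/perm_inj e1 /perm_inj e2].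
by apply: (fo v w vw); rewrite e1 e2.
Qed.

Lemma sum_row_count f (P : pred (state d)) :
  (\sum_(x | P x) vecZ (row_count f) (enum_rank x) 0 =
   \sum_p (P (f p))%:R :> int)%R.
Proof.
under eq_bigr => x _ do rewrite !mxE enum_rankK.
rewrite -(big_morph Posz PoszD (erefl _)) -natr_sum natz; congr Posz.
under eq_bigr => x _ do rewrite -sum1_card.
rewrite (exchange_big_dep xpredT)//=; apply: eq_bigr => p _.
rewrite [LHS](eq_bigl (fun x => (x == f p) && P (f p))); last first.
  by move=> x; rewrite inE eq_sym; case: eqP => [->|]; rewrite ?andbT ?andbF.
by case: (P (f p)); [rewrite (big_pred1 (f p))// => x; rewrite andbT
                    | rewrite big_pred0// => x; rewrite andbF].
Qed.

(** [F] factors through the coordinates [v] and [w], and these run through all pairs once along any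
    orthogonal array; both sums are thus the same sum over [T]. *)
Lemma orthogonal_array_sum (f g : T -> state d) v w (F : state d -> int) :
  orthogonal_array f -> orthogonal_array g -> v != w ->
  (forall x y : state d, x v = y v -> x w = y w -> F x = F y) ->
  (\sum_p F (f p) = \sum_p F (g p))%R.
Proof.
move=> fo go vw FE.
pose Q (p : T) := F [ffun z => if z == v then p.1 else p.2].
have QE x : F x = Q (x v, x w).
  by apply: FE; rewrite ffunE ?eqxx // eq_sym (negPf vw).
have sumE h : orthogonal_array h -> (\sum_p F (h p) = \sum_p Q p)%R.
  move=> ho; rewrite [RHS](reindex_inj (ho v w vw)).
  by apply: eq_bigr => p _; exact: QE.
by rewrite !sumE.
Qed.

(** A third vertex would close a triangle. Smaller cliques are padded to two distinct vertices,
    which [1 < N] provides. *)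
Lemma triangle_free_clique (W : {set 'I_N}) :
  triangle_free G -> (1 < N)%N -> clique G W ->
  exists v w : 'I_N, v != w /\ W \subset [set v; w].
Proof.
move=> tf N1 /forall_inP cW.
have adjW v w : v \in W -> w \in W -> v != w -> G v w.
  by move=> vW wW; exact/implyP/(forall_inP (cW _ vW)).
have [->|[v vW]] := set_0Vmem W.
  exists (Ordinal (ltnW N1)), (Ordinal N1); split => //; exact: finset.sub0set.
have [e|[w]] := set_0Vmem (W :\ v).
  have [w vw] : exists w, v != w.
    have [e0|] := eqVneq v (Ordinal N1); last by exists (Ordinal N1).
    by exists (Ordinal (ltnW N1)); rewrite e0.
  exists v, w; split=> //; apply/fintype.subsetP => z zW; rewrite !inE.
  by have /setP/(_ z) := e; rewrite !inE zW andbT => /negbFE ->.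
rewrite !inE => /andP[wv wW]; exists v, w; split; first by rewrite eq_sym.
apply/fintype.subsetP => z zW; rewrite !inE; apply: contra_notT tf => /norP[zv zw].
exists [:: v; w; z]; split=> //; rewrite /ucycle /= !inE !andbT.
have {}wv : v != w by rewrite eq_sym.
have {}zv : v != z by rewrite eq_sym.
have {}zw : w != z by rewrite eq_sym.
by rewrite !adjW// 1?eq_sym// !negb_or eq_sym wv zv zw.
Qed.

Lemma orthogonal_array_margins (f g : T -> state d) :
  triangle_free G -> (1 < N)%N ->
  orthogonal_array f -> orthogonal_array g ->
  (design_matrix G d *m vecZ (row_count f) =
   design_matrix G d *m vecZ (row_count g))%R.
Proof.
move=> tf N1 fo go; apply/colP => i; rewrite -(enum_valK i).
case: (enum_val i) => -[W cW] y; rewrite !design_matrixE !sum_row_count /=.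
have [v [w [vw Wvw]]] := triangle_free_clique tf N1 cW.
apply: (orthogonal_array_sum (F := fun x => (Defs.restrict W x == y)%:R%R) fo go vw).
move=> x x' xv xw; congr ((_ == y)%:R%R); apply/ffunP => -[z zW]; rewrite !ffunE /=.
by have /(fintype.subsetP Wvw) := zW; rewrite !inE => /orP[] /eqP ->.
Qed.

Lemma row_count_gt0 (f : T -> state d) x :
  (0 < row_count f (enum_rank x) 0%R)%N -> exists p, f p = x.
Proof.
by rewrite mxE enum_rankK => /card_gt0P[p]; rewrite inE => /eqP <-; exists p.
Qed.

(** * Global moves and isolation in the fiber *)

Lemma global_moveN (e : 'I_N -> nat) (m : 'cV[int]_#|state e|) :
  global_move G m -> global_move G (- m)%R.
Proof.
case=> A [B [C [x [x' [ABC sep ->]]]]].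
(* Exchanging the [B]-parts of [x] and [x'] swaps the positive and negative terms. *)
exists A, B, C, (Defs.glue A B x x' x), (Defs.glue A B x' x x); split=> //.
have glueE (p q r p' q' r' p2 q2 r2 : state e) :
    Defs.glue A B (Defs.glue A B p q r) (Defs.glue A B p' q' r')
      (Defs.glue A B p2 q2 r2) = Defs.glue A B p q' r2.
  by apply/ffunP => v; rewrite !ffunE; case: (v \in A); case: (v \in B).
rewrite !glueE.
by rewrite -[X in (- X)%R]addrA -opprD opprB opprD addrA.
Qed.

(** Deleting at most one vertex leaves [G] connected, so a [C] that small would be avoided by some
    path from [A] to [B]. *)
Lemma two_connected_separator (A B C : {set 'I_N}) :
  two_connected G -> tripartition A B C -> separates G A B C ->
  A != finset.set0 -> B != finset.set0 -> (1 < #|C|)%N.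
Proof.
case=> _ conn conn1 /and4P[_ _ AC BC] sep /set0Pn[a aA] /set0Pn[b bB].
rewrite ltnNge; apply/negP => C1.
have connC : connected_on G (~: C).
  have [->|[z zC]] := set_0Vmem C; first by rewrite finset.setC0.
  have -> // : C = [set z].
  by apply/esym/eqP; rewrite eqEcard finset.sub1set zC cards1.
have aC : a \in ~: C by rewrite inE (disjointFr AC aA).
have bC : b \in ~: C by rewrite inE (disjointFr BC bB).
have /connectP[p pP bE] := connC a b aC bC.
(* [separates] speaks of paths without repeated vertices only. *)
case: (shortenP pP) bE => q qP uq _ bE.
have qG : path G a q by apply: sub_path qP => s t /and3P[].
have := sep a q qG uq aA; rewrite -bE => /(_ bB) /hasP[z].
rewrite inE => /predU1P[->|zq] zC; first by move: aC; rewrite inE zC.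
suff /allP/(_ z zq) : all (mem (~: C)) q by rewrite /= inE zC.
elim: q a {uq bE qG aA aC pP zq} qP => //= s q IH a /andP[/and3P[_ sC _] /IH ->].
by rewrite sC.
Qed.

Lemma row_count_isolated (f : T -> state d) (m : 'cV[int]_#|state d|)
    (v : 'cV[nat]_#|state d|) :
  two_connected G -> orthogonal_array f -> global_move G m ->
  (vecZ v = vecZ (row_count f) + m)%R -> v = row_count f.
Proof.
move=> G2 fo [A [B [C [x [x' [ABC sep ->]]]]]].
set a := Defs.glue _ _ _ _ _; set b := Defs.glue _ _ _ _ _.
set c := Defs.glue _ _ _ _ _; set e := Defs.glue _ _ _ _ _ => vE.
have vecZ_inj : injective (@vecZ #|state d|).
  move=> s t /colP st; apply/colP => i.
  by have := st i; rewrite !mxE => -[].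
(* If [x] and [x'] agree on [B], or on [A], the terms of the move cancel in pairs and the move is
   zero. *)
have [BE|/forall_inPn[w2 w2B x2]] := boolP [forall z in B, x z == x' z].
  have {}BE z : z \in B -> x z = x' z by move=> zB; exact/eqP/(forall_inP BE).
  have ac : a = c.
    by apply/ffunP => z; rewrite !ffunE; do 2?case: ifP => // ?; exact: BE.
  have be : b = e.
    by apply/ffunP => z; rewrite !ffunE; do 2?case: ifP => // ?; exact/esym/BE.
  by apply: vecZ_inj; rewrite vE ac be addrAC addrK subrr addr0.
have [AE|/forall_inPn[w1 w1A x1]] := boolP [forall z in A, x z == x' z].
  have {}AE z : z \in A -> x z = x' z by move=> zA; exact/eqP/(forall_inP AE).
  have ae : a = e.
    by apply/ffunP => z; rewrite !ffunE; case: ifP => // ?; exact: AE.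
  have bc : b = c.
    by apply/ffunP => z; rewrite !ffunE; case: ifP => // ?; exact/esym/AE.
  by apply: vecZ_inj; rewrite vE ae bc addrK subrr addr0.
have /(two_connected_separator G2 ABC sep) : A != finset.set0.
  by apply/set0Pn; exists w1.
have /[swap]/[apply] : B != finset.set0.
  by apply/set0Pn; exists w2.
case/and4P: (ABC) => _ AB AC BC.
have w2A := disjointFl AB w2B.
have ac : a != c.
  by apply: contra x2 => /eqP/ffunP/(_ w2); rewrite !ffunE w2A w2B => ->.
have bc : b != c.
  by apply: contra x1 => /eqP/ffunP/(_ w1); rewrite !ffunE w1A => ->.
have ae : a != e.
  by apply: contra x1 => /eqP/ffunP/(_ w1); rewrite !ffunE w1A => ->.
have be : b != e.
  by apply: contra x2 => /eqP/ffunP/(_ w2); rewrite !ffunE w2A w2B => ->.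
have ce : c != e.
  by apply: contra x1 => /eqP/ffunP/(_ w1); rewrite !ffunE w1A => ->.
have vcE t : (vecZ v (enum_rank t) 0 = vecZ (row_count f) (enum_rank t) 0 +
    ((t == a)%:R + (t == b)%:R - (t == c)%:R - (t == e)%:R))%R.
  by rewrite vE mxE; congr (_ + _)%R; rewrite !mxE !(inj_eq enum_rank_inj) !andbT.
(* The move is -1 at [c] and at [e], as these differ from each other and from [a] and [b]; the
   nonnegativity of [v] forces both to be rows of [f]. *)
have row t : (t == c) || (t == e) -> exists p, f p = t.
  move=> tce; apply: row_count_gt0; rewrite lt0n; apply/eqP => rc.
  have := vcE t; rewrite mxE [X in (_ = X + _)%R]mxE rc.
  case/orP: tce => /eqP ->; rewrite eqxx.
    by rewrite ![c == _]eq_sym (negPf ac) (negPf bc) [e == c]eq_sym (negPf ce).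
  by rewrite ![e == _]eq_sym (negPf ae) (negPf be) (negPf ce).
have [p fp] := row c (predU1l _ erefl).
have [q fq] : exists q, f q = e by apply: row; rewrite eqxx orbT.
case/card_gt1P => z1 [z2 [z1C z2C z12]].
have fpq z : z \in C -> f p z = f q z.
  by move=> zC; rewrite fp fq !ffunE (disjointFl AC zC) (disjointFl BC zC).
have pq : p = q by apply: (fo z1 z2 z12); rewrite !fpq.
by move: ce; rewrite -fp -fq pq eqxx.
Qed.

Lemma row_count_joined (f : T -> state d) v :
  two_connected G -> orthogonal_array f ->
  joined_by (@global_move N G d) (row_count f) v -> v = row_count f.
Proof.
move=> G2 fo [k [w [w0 <- wS]]].
elim: k wS => // k IH wS.
have wk : w k = row_count f by apply: IH => i ik; apply: wS; exact: ltnW.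
have := wS k (ltnSn k); rewrite wk => mv.
apply: (@row_count_isolated f (vecZ (w k.+1) - vecZ (row_count f))%R) => //.
  by case: mv => // /global_moveN; rewrite opprK.
by rewrite addrC subrK.
Qed.

(** * The array of the Latin squares and a second element of its fiber *)

Lemma orthogonal_array_of_squares (L : 'I_(N - 2) -> 'M['I_d0]_d0) :
  mutually_orthogonal_latin_squares L -> exists f, orthogonal_array f.
Proof.
case=> latL orthL.
pose f (p : T) : state d := [ffun v : 'I_N =>
  (* Vertices 0 and 1 carry the row and column indices, vertex [k.+2] the entry of square [k]. The
     default [p.1] is never reached, since [k.+2 < N] gives [k < N - 2]. *)
  if val v is k.+2 then oapp (fun l => L l p.1 p.2) p.1 (insub k)
  else if val v == 0 then p.1 else p.2].
exists f.
have f2 k (k2 : k < N) : 1 < k ->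
    exists2 l : 'I_(N - 2), val l = k - 2 & forall p, f p (Ordinal k2) = L l p.1 p.2.
  case: k k2 => [|[|k]] // k2 _.
  have k3 : k < N - 2 by rewrite ltn_subRL.
  by exists (Ordinal k3) => [|p]; rewrite /= ?subSS ?subn0 // ffunE /= insubT.
suff H (v w : 'I_N) : v < w -> injective (fun p => (f p v, f p w)).
  move=> v w vw; have [/H//|wv p q [e1 e2]|/val_inj e] := ltngtP v w.
    by apply: (H _ _ wv); rewrite e1 e2.
  by rewrite e eqxx in vw.
(* The cases are: both indices; row index and square, by uniqueness within a row; column index and
   square, by uniqueness within a column; two squares, by orthogonality. *)
case: v w => [[|[|v]] v2] [[|[|w]] w2] //= vw [i j] [k l];
  try have [lw lwE /(_ _) fw] := f2 _ w2 isT.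
- by rewrite !ffunE /= => -[-> ->].
- rewrite !fw [f _ _]ffunE [f (k, l) _]ffunE /= => -[-> e].
  have [t [_ u]] := (latL lw).1 k (L lw k l).
  by congr pair; rewrite -(u j e) (u l).
- rewrite !fw [f _ _]ffunE [f (k, l) _]ffunE /= => -[-> e].
  have [t [_ u]] := (latL lw).2 l (L lw k l).
  by congr pair; rewrite -(u i e) (u k).
have [lv lvE fv] := f2 _ v2 isT.
rewrite !fw !fv => -[e1 e2].
have lvw : lv != lw by rewrite -val_eqE lvE lwE !subSS !subn0 neq_ltn (vw : v < w).
by have [-> ->] := orthL lv lw lvw i j k l (congr2 pair e1 e2).
Qed.

(** Moving one symbol of the row [f p] at [v0] alone yields a state still agreeing with [f p] at
    [v1] and [v2]. Were it a row of [f], it would be [f p] itself. *)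
Lemma twist_row_count_neq (f : T -> state d) :
  (2 < N)%N -> (1 < d0)%N -> orthogonal_array f ->
  exists s, row_count (twist s f) <> row_count f.
Proof.
move=> N2 d1 fo.
pose v0 := Ordinal (ltnW (ltnW N2)).
pose v1 := Ordinal (ltnW N2); pose v2 := Ordinal N2.
pose i0 := Ordinal (ltnW d1); pose i1 := Ordinal d1.
pose p := (i0, i0).
have [j jp] : exists j, j != f p v0.
  have [e|] := eqVneq i0 (f p v0); last by exists i0.
  by exists i1; rewrite -e.
pose s := [ffun v => if v == v0 then tperm (f p v0) j else 1%g].
exists s => rc; have [q fq] : exists q, f q = twist s f p.
  apply: row_count_gt0; rewrite -rc mxE enum_rankK; apply/card_gt0P.
  by exists p; rewrite inE.
have fqv v : v != v0 -> f q v = f p v.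
  by move=> vv; rewrite fq !ffunE (negPf vv) perm1.
have pq : p = q by apply: (fo v1 v2) => //; rewrite !fqv.
have /ffunP/(_ v0) := fq; rewrite -pq !ffunE eqxx tpermL => e.
by rewrite -e eqxx in jp.
Qed.

(* The average of the row counts of all twists of f has the same margins as f,
   and it is positive everywhere since every state is a row of some twist. *)
Lemma row_count_relative_interior (R : realType) (f : T -> state d) :
  triangle_free G -> (1 < N)%N -> orthogonal_array f ->
  relative_interior (cone_of_columns (map_mx intr (design_matrix G d)))
    (map_mx intr (design_matrix G d *m vecZ (row_count f))%R :
      'cV[R]_#|margin_index G d|).
Proof.
move=> tf N1 fo.
pose K : R := (#|{ffun 'I_N -> {perm 'I_d0}}|%:R)%R.
have K0 : (0 < K)%R by rewrite ltr0n; apply/card_gt0P; exists [ffun=> 1%g].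
pose c := (K^-1 *: \sum_s map_mx intr (vecZ (row_count (twist s f))) :
             'cV[R]_#|state d|)%R.
have -> : (map_mx intr (design_matrix G d *m vecZ (row_count f)) =
    map_mx intr (design_matrix G d) *m c)%R.
  rewrite /c -scalemxAr mulmx_sumr.
  under eq_bigr => s _ do rewrite -map_mxM
    -(orthogonal_array_margins tf N1 fo (orthogonal_array_twist fo)).
  by rewrite sumr_const -scaler_nat scalerA mulVf ?gt_eqF// scale1r.
apply: relative_interior_cone_of_columns => j.
rewrite !mxE summxE mulr_gt0 ?invr_gt0//.
(* The state [x] supplies a symbol [i], hence a row index [(i, i)]; transpositions at each vertex
   carry that row to [x]. *)
pose x := enum_val j; pose i := x (Ordinal N1).
pose s := [ffun v => tperm (f (i, i) v) (x v)].
rewrite (bigD1 s)//= ltr_wpDr//.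
  by apply: sumr_ge0 => t _; rewrite !mxE ler0z.
rewrite !mxE ltr0z ltz_nat; apply/card_gt0P; exists (i, i).
by rewrite inE; apply/eqP/ffunP => v; rewrite !ffunE tpermL.
Qed.

End OrthogonalArrays.

Theorem theorem4p12 (R : realType) (N d0 : nat) (hN : (1 < N)%N)
    (G : sgraph N) (hG2 : two_connected G) (hG3 : triangle_free G)
    (hd0 : (2 <= d0)%N)
    (hL : exists L : 'I_(N - 2) -> 'M['I_d0]_d0,
            mutually_orthogonal_latin_squares L) :
  ~ interior_point_property R G (fun _ : 'I_N => d0).
Proof.
move=> ipp; have [L /orthogonal_array_of_squares[f fo]] := hL.
have N2 : (2 < N)%N by case: hG2.
have [s neq] := twist_row_count_neq N2 hd0 fo.
(* The twisted array lies in the same fiber, so the interior point property would join it to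
   [row_count f], which is joined only to itself. *)
apply/neq/(row_count_joined hG2 fo).
apply: ipp (row_count_relative_interior R hG3 hN fo) _ _ _ _ => //.
exact: orthogonal_array_margins hG3 hN (orthogonal_array_twist fo) fo.
Qed.
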